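(* Let $K$ be a field of characteristic different from two, let $D$ be a (finite-dimensional) central division algebra over $K$ (that is, with center $K$) equipped with an involution $\bar{\phantom{x}}$, and let $n\geq 1$. Let $\varepsilon_0,\varepsilon\in\{1,-1\}$, let $S\in GL_n(D)$ satisfy $\bar{S}^t=\varepsilon_0 S$, and let $*$ be the involution on $M_n(D)$ given by $X^*=S\bar{X}^tS^{-1}$ for all $X\in M_n(D)$. Let $M$ be a right $M_n(D)$-module and let $h:M\times M\to M_n(D)$ be an $\varepsilon$-hermitian form with respect to $*$. Then the form $$S^{-1}h: M\times M\to M_n(D),\quad (x,y)\mapsto S^{-1}h(x,y)$$ is $\varepsilon_0\varepsilon$-hermitian over $(M_n(D),\bar{\phantom{x}}^t)$.
   Context: An involution on a ring is an additive anti-automorphism of order at most two; the involution on $D$ is not assumed to be trivial on $K$. For a matrix $X=(x_{ij})$ over $D$, $\bar{X}^t$ denotes the conjugate transpose, whose $(i,j)$ entry is $\overline{x_{ji}}$; the map $X\mapsto\bar{X}^t$ is an involution on $M_n(D)$, denoted $\bar{\phantom{x}}^t$. Let $(R,\sigma)$ be a ring with involution, $M$ a right $R$-module and $\delta\in\{1,-1\}$. A sesquilinear form over $(R,\sigma)$ (or with respect to $\sigma$) on $M$ is a biadditive map $h:M\times M\to R$ with $h(x\alpha,y\beta)=\sigma(\alpha)h(x,y)\beta$ for all $x,y\in M$ and $\alpha,\beta\in R$. It is $\delta$-hermitian if in addition $h(y,x)=\delta\,\sigma(h(x,y))$ for all $x,y\in M$. *)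

(* Defs.v *)
From mathcomp Require Import all_boot all_algebra all_field.

Set Implicit Arguments.
Unset Strict Implicit.
Unset Printing Implicit Defensive.

Import GRing.Theory.
Local Open Scope ring_scope.

(* The identity [s 1 = 1] is a consequence of the last two fields. *)
Record involution (R : pzRingType) := Involution {
  inv_fun :> R -> R;
  inv_add : {morph inv_fun : x y / x + y};
  inv_antimul : forall x y, inv_fun (x * y) = inv_fun y * inv_fun x;
  inv_invol : involutive inv_fun
}.

Definition conjtr (R : pzRingType) n (s : R -> R) (X : 'M[R]_n) : 'M[R]_n :=
  map_mx s X^T.

Section ConjugateTranspose.
Variables (R : pzRingType) (s : involution R) (n : nat).

Fact involution0 : s 0 = 0.
Proof. by apply: (@addrI _ (s 0)); rewrite -inv_add !addr0. Qed.

Fact conjtr_add : {morph @conjtr R n s : X Y / X + Y}.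
Proof. by move=> X Y; apply/matrixP=> i j; rewrite !mxE inv_add. Qed.

Fact conjtr_antimul (X Y : 'M[R]_n) :
  conjtr s (X * Y) = conjtr s Y * conjtr s X.
Proof.
apply/matrixP=> i j; rewrite !mxE (big_morph s (@inv_add _ s) involution0).
by apply: eq_bigr => k _; rewrite !mxE inv_antimul.
Qed.

Fact conjtr_invol : involutive (@conjtr R n s).
Proof. by move=> X; apply/matrixP=> i j; rewrite !mxE inv_invol. Qed.

Definition conjtr_involution : involution 'M[R]_n :=
  Involution conjtr_add conjtr_antimul conjtr_invol.

End ConjugateTranspose.

(* A right R-module is a left module over the converse ring R^c. *)
Definition rscale (R : pzRingType) (M : lmodType R^c) (x : M) (a : R) : M :=
  (a : R^c) *: x.

Record sesquilinear_form (R : pzRingType) (s : involution R) (M : lmodType R^c)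
    (h : M -> M -> R) : Prop := Sesquilinear {
  sesqDl : forall x y z, h (x + y) z = h x z + h y z;
  sesqDr : forall x y z, h x (y + z) = h x y + h x z;
  sesqZ : forall x y a b, h (rscale x a) (rscale y b) = s a * h x y * b
}.

(* Signs are integers, acting on the ring by [*~], so that one sign can be used
   both for forms with values in 'M[D]_n and for matrices. *)
Record hermitian_form (R : pzRingType) (delta : int) (s : involution R)
    (M : lmodType R^c) (h : M -> M -> R) : Prop := Hermitian {
  herm_sesq : sesquilinear_form s h;
  herm_sym : forall x y, h y x = s (h x y) *~ delta
}.

(* Main.v *)
Require Import Defs.
From mathcomp Require Import all_boot all_algebra all_field.

Set Implicit Arguments.
Unset Strict Implicit.
Unset Printing Implicit Defensive.

Import GRing.Theory.
Local Open Scope ring_scope.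

(** Scaling a form by [S^-1] turns hermitian forms for a twisted involution into
    hermitian forms for the original one.  The argument takes place in an arbitrary
    ring with involution [s], twisted into [t x = u * s x * v] by a unit [u] with
    inverse [v], where [s u = u *~ e0] and [e0] is a sign.

    Left multiplication by [v] cancels the [u] of [t], so that
    [v * t x = s x * v] ([mul_twist]): moving [v] past a value of [t] turns it into
    a value of [s].  This alone makes [v * h] sesquilinear over [s].  For the
    symmetry, the inverse [v] has the same sign as [u] ([involution_inverse_sign]),
    whence [s (v * h x y) = s (h x y) * v *~ e0], while
    [v * h y x = v * t (h x y) *~ e = s (h x y) * v *~ e]; the two differ by
    the sign [e0 * e], since [e0 * e0 = 1].  The ring of matrices with the conjugate
    transpose is the case of interest. *)

Lemma involution1 (R : pzRingType) (s : involution R) : s 1 = 1.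
Proof. by rewrite -[RHS](inv_invol s) -[s 1 in RHS]mulr1 inv_antimul inv_invol mulr1. Qed.

Section Twist.
Variables (R : pzRingType) (s t : involution R) (u v : R) (e0 : int).
Hypotheses (uv1 : u * v = 1) (vu1 : v * u = 1) (e0K : e0 * e0 = 1).
Hypothesis su : s u = u *~ e0.
Hypothesis tE : forall x, t x = u * s x * v.

(** Applying [s] to [u * v = 1] gives [(s v * u) *~ e0 = 1], and a sign is its
    own inverse. *)
Lemma involution_inverse_sign : s v = v *~ e0.
Proof.
have svu : (s v * u) *~ e0 = 1 by rewrite -mulrzAr -su -inv_antimul uv1 involution1.
have -> : s v = (s v * u) * v by rewrite -mulrA uv1 mulr1.
by rewrite -[s v * u]mulr1z -e0K mulrzA svu mulrzAl mul1r.
Qed.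

Lemma mul_twist x : v * t x = s x * v.
Proof. by rewrite tE !mulrA vu1 mul1r. Qed.

Lemma hermitian_form_untwist (M : lmodType R^c) (h : M -> M -> R) (e : int) :
  hermitian_form e t h -> hermitian_form (e0 * e) s (fun x y => v * h x y).
Proof.
case=> -[hDl hDr hZ] hC; split; first split=> [x y z|x y z|x y a b].
- by rewrite hDl mulrDr.
- by rewrite hDr mulrDr.
- by rewrite hZ !mulrA mul_twist.
move=> x y.
by rewrite hC mulrzAr mul_twist inv_antimul involution_inverse_sign mulrzAr
           -mulrzA mulrA e0K mul1r.
Qed.

End Twist.

Theorem proposition2p1
  (K : fieldType) (charK : 2%N \notin [pchar K])
  (D : falgType K)
  (divD : forall x : D, x != 0 -> x \is a GRing.unit)
  (centerD : 'Z({:D})%VS = 1%VS)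
  (bar : involution D)
  (n : nat) (n_ge1 : (1 <= n)%N)
  (eps0 eps : int) (eps0P : eps0 = 1 \/ eps0 = -1) (epsP : eps = 1 \/ eps = -1)
  (S Sinv : 'M[D]_n) (SSinv : S *m Sinv = 1%:M) (SinvS : Sinv *m S = 1%:M)
  (barS : conjtr bar S = S *~ eps0)
  (star : involution 'M[D]_n)
  (starE : forall X : 'M[D]_n, star X = S *m conjtr bar X *m Sinv)
  (M : lmodType ('M[D]_n)^c) (h : M -> M -> 'M[D]_n)
  (hP : hermitian_form eps star h) :
  hermitian_form (eps0 * eps) (conjtr_involution bar n)
    (fun x y : M => Sinv *m h x y).
Proof.
have eps0K : eps0 * eps0 = 1 by case: eps0P => ->.
exact: (@hermitian_form_untwist _ (conjtr_involution bar n) star S Sinv).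
Qed.
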